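(* (Heyting implicative Visser's rules for $\mathsf{iK_d}$) Let $I$ and $J$ be finite sets (possibly empty), let $\{m_i\}_{i \in I}$ and $\{n_j\}_{j \in J}$ be sequences of natural numbers, let $k$ be a natural number, and let $A_i,B_i$ ($i\in I$), $C_j,D_j$ ($j\in J$), $E$, $F$ be formulas. If $$\mathsf{iK_d} \vdash \Big[\bigwedge_{i \in I} \nabla^{m_i}(A_i \supset B_i) \wedge \bigwedge_{j \in J} \nabla^{n_j} (C_j \rightarrow D_j)\Big] \rightarrow \nabla^k(E \supset F),$$ then one of the following holds: - $\mathsf{iK_d} \vdash [\bigwedge_{i \in I} \nabla^{m_i}(A_i \supset B_i) \wedge \bigwedge_{j \in J} \nabla^{n_j} (C_j \rightarrow D_j)] \rightarrow \nabla^{m_{i_0}} A_{i_0}$, for some $i_0 \in I$; - $\mathsf{iK_d} \vdash [\bigwedge_{i \in I} \nabla^{m_i}(A_i \supset B_i) \wedge \bigwedge_{j \in J} \nabla^{n_j} (C_j \rightarrow D_j)] \rightarrow \nabla^{n_{j_0}-1} C_{j_0}$, for some $j_0 \in J$ with $n_{j_0} \geq 1$; - $\mathsf{iK_d} \vdash [\bigwedge_{i \in I'} \nabla^{m_i-k}(A_i \supset B_i) \wedge \bigwedge_{j \in J'} \nabla^{n_j-k} (C_j \rightarrow D_j) \wedge E] \rightarrow F$, for some $I' \subseteq I$ and $J' \subseteq J$ such that $m_i, n_j \geq k$ for all $i \in I'$ and $j \in J'$.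
   Context: Language and sequents. Fix a set $V$ of atomic propositions. $\mathcal{L}$-formulas (simply ''formulas'') are built from atoms in $V$ and the constants $\top,\bot$ using binary connectives $\wedge,\vee,\supset,\to$ and the unary connective $\nabla$. $\nabla^n A$ is the $n$-fold application of $\nabla$ to $A$, and $\nabla\Gamma=\{\nabla A \mid A\in\Gamma\}$ as a multiset. $\bigwedge$ denotes finite iterated conjunction, with the empty conjunction equal to $\top$. Natural numbers include $0$. A sequent is an expression $\Gamma\Rightarrow\Delta$ with $\Gamma,\Delta$ finite multisets of formulas, $\Delta$ containing at most one formula. Comma is multiset union; a formula stands for its singleton. Calculus $\mathbf{STL(N,H)}$ (over $\mathcal{L}$). Rules are written ''premises / conclusion''; $\Gamma,\Sigma$ are arbitrary finite multisets, $\Delta$ has at most one formula, $A,B$ are arbitrary formulas. Axioms: $(Id)$ $A\Rightarrow A$; $(L\bot)$ $\bot\Rightarrow$; $(R\top)$ $\Rightarrow\top$. $(Lw)$ $\Gamma\Rightarrow\Delta$ / $\Gamma,A\Rightarrow\Delta$. $(Rw)$ $\Gamma\Rightarrow$ / $\Gamma\Rightarrow A$. $(Lc)$ $\Gamma,A,A\Rightarrow\Delta$ / $\Gamma,A\Rightarrow\Delta$. $(cut)$ $\Gamma\Rightarrow A$ and $\Sigma,A\Rightarrow\Delta$ / $\Sigma,\Gamma\Rightarrow\Delta$. $(L\wedge_1)$ $\Gamma,A\Rightarrow\Delta$ / $\Gamma,A\wedge B\Rightarrow\Delta$. $(L\wedge_2)$ $\Gamma,B\Rightarrow\Delta$ /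 $\Gamma,A\wedge B\Rightarrow\Delta$. $(R\wedge)$ $\Gamma\Rightarrow A$ and $\Gamma\Rightarrow B$ / $\Gamma\Rightarrow A\wedge B$. $(L\vee)$ $\Gamma,A\Rightarrow\Delta$ and $\Gamma,B\Rightarrow\Delta$ / $\Gamma,A\vee B\Rightarrow\Delta$. $(R\vee_1)$ $\Gamma\Rightarrow A$ / $\Gamma\Rightarrow A\vee B$. $(R\vee_2)$ $\Gamma\Rightarrow B$ / $\Gamma\Rightarrow A\vee B$. $(N)$ $\Gamma\Rightarrow\Delta$ / $\nabla\Gamma\Rightarrow\nabla\Delta$. $(L\to)$ $\Gamma\Rightarrow A$ and $\Gamma,B\Rightarrow\Delta$ / $\Gamma,\nabla(A\to B)\Rightarrow\Delta$. $(R\to)$ $\nabla\Gamma,A\Rightarrow B$ / $\Gamma\Rightarrow A\to B$. $(L\supset)$ $\Gamma\Rightarrow A$ and $\Gamma,B\Rightarrow\Delta$ / $\Gamma,A\supset B\Rightarrow\Delta$. $(R\supset)$ $\Gamma,A\Rightarrow B$ / $\Gamma\Rightarrow A\supset B$. The logic $\mathsf{iK_d}$ is the set of formulas $A$ such that $\Rightarrow A$ has a proof-tree in $\mathbf{STL(N,H)}$; $\mathsf{iK_d}\vdash A$ means $A\in\mathsf{iK_d}$. *)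

(* Defs.v *)
From mathcomp Require Import all_boot.
From Stdlib Require Import Permutation.

Set Implicit Arguments.
Unset Strict Implicit.
Unset Printing Implicit Defensive.

Inductive form (V : Type) : Type :=
  | Atom of V
  | Top
  | Bot
  | And of form V & form V
  | Or of form V & form V
  | Himp of form V & form V
  | Timp of form V & form V
  | Nabla of form V.

Arguments Top {V}.
Arguments Bot {V}.

Declare Scope form_scope.
Delimit Scope form_scope with form.
Bind Scope form_scope with form.

(* [A ~> B] is the temporal implication, whose left rule is guarded by nabla;
   [A ⊃ B] is the Heyting implication. *)
Notation "A ∧ B" := (And A B) (at level 40, left associativity) : form_scope.
Notation "A ∨ B" := (Or A B) (at level 50, left associativity) : form_scope.
Notation "A ⊃ B" := (Himp A B) (at level 55, right associativity) : form_scope.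
Notation "A ~> B" := (Timp A B) (at level 55, right associativity) : form_scope.
Notation "∇ A" := (Nabla A) (at level 30, right associativity) : form_scope.
Notation "∇^ n A" := (iter n (@Nabla _) A)
  (at level 30, n at level 9, A at level 30, format "∇^ n  A") : form_scope.

Local Open Scope form_scope.

Fixpoint bigand (V : Type) (s : seq (form V)) : form V :=
  match s with
  | [::] => Top
  | [:: A] => A
  | A :: s' => A ∧ bigand s'
  end.

(* Finite conjunctions are taken in the order of the enumeration of the finite
   index type. *)
Notation "⋀_ ( i : I ) A" := (bigand [seq A%form | i : I])
  (at level 35, i name, A at level 35, format "⋀_ ( i  :  I )  A") : form_scope.
Notation "⋀_ ( i 'in' S ) A" := (bigand [seq A%form | i in S])
  (at level 35, i name, A at level 35, format "⋀_ ( i  'in'  S )  A")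
  : form_scope.

Reserved Notation "Γ ⇒ Δ" (at level 70, no associativity).

(* The multiset antecedent is a list taken up to permutation (rule [Ex]); the
   succedent, which has at most one formula, is an option. *)
Inductive STL_NH (V : Type) : seq (form V) -> option (form V) -> Prop :=
  | Ex Γ Γ' Δ : Permutation Γ Γ' -> Γ ⇒ Δ -> Γ' ⇒ Δ
  | Id A : [:: A] ⇒ Some A
  | Lbot : [:: Bot] ⇒ None
  | Rtop : [::] ⇒ Some Top
  | Lw Γ Δ A : Γ ⇒ Δ -> A :: Γ ⇒ Δ
  | Rw Γ A : Γ ⇒ None -> Γ ⇒ Some A
  | Lc Γ Δ A : A :: A :: Γ ⇒ Δ -> A :: Γ ⇒ Δ
  | Cut Γ Σ Δ A : Γ ⇒ Some A -> A :: Σ ⇒ Δ -> Σ ++ Γ ⇒ Δ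
  | Land1 Γ Δ A B : A :: Γ ⇒ Δ -> A ∧ B :: Γ ⇒ Δ
  | Land2 Γ Δ A B : B :: Γ ⇒ Δ -> A ∧ B :: Γ ⇒ Δ
  | Rand Γ A B : Γ ⇒ Some A -> Γ ⇒ Some B -> Γ ⇒ Some (A ∧ B)
  | Lor Γ Δ A B : A :: Γ ⇒ Δ -> B :: Γ ⇒ Δ -> A ∨ B :: Γ ⇒ Δ
  | Ror1 Γ A B : Γ ⇒ Some A -> Γ ⇒ Some (A ∨ B)
  | Ror2 Γ A B : Γ ⇒ Some B -> Γ ⇒ Some (A ∨ B)
  | RuleN Γ Δ : Γ ⇒ Δ -> map (@Nabla V) Γ ⇒ omap (@Nabla V) Δ
  | Ltimp Γ Δ A B : Γ ⇒ Some A -> B :: Γ ⇒ Δ -> ∇ (A ~> B) :: Γ ⇒ Δ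
  | Rtimp Γ A B : A :: map (@Nabla V) Γ ⇒ Some B -> Γ ⇒ Some (A ~> B)
  | Lhimp Γ Δ A B : Γ ⇒ Some A -> B :: Γ ⇒ Δ -> A ⊃ B :: Γ ⇒ Δ
  | Rhimp Γ A B : A :: Γ ⇒ Some B -> Γ ⇒ Some (A ⊃ B)
where "Γ ⇒ Δ" := (STL_NH Γ Δ).

Definition iKd (V : Type) (A : form V) : Prop := [::] ⇒ Some A.

(* Main.v *)
From Stdlib Require Import Permutation List Classical.
Require Import Defs.
From mathcomp Require Import all_boot.

(** The proof is a Kleene-Aczel slash, the syntactic form of gluing a new root
    below Kripke models.

    The logic is sound for posets with a monotone map [π], where [∇ A] holds at
    [w] when [A] holds at [π w], and [A ~> B] holds at [w] when every [v] with
    [w <= π v] that satisfies [A] satisfies [B].  Suppose that the first two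
    alternatives fail for the antecedent [X], and let [Y] be the antecedent of
    the third one for the largest admissible index sets.  Take all models of [X] and of [Y], and add fresh points
    [r 0, r 1, ...] with [π (r l) = r l.+1], where [r l] lies below the [l]-fold
    [π]-image of every model of [X] and, once [k <= l], below the [(l-k)]-fold
    image of every model of [Y].  Then
    - [r 0] satisfies [∇^m (A ⊃ B)]: what lies strictly above [r m] satisfies
      [A ⊃ B], and [r m] itself does not satisfy [A], because some model of [X]
      refutes [∇^m A];
    - [r 0] satisfies [∇^n (C ~> D)] likewise: the only new point whose
      [π]-image is above [r n] is [r n.-1] (none if [n = 0]), and it does not
      satisfy [C], because some model of [X] refutes [∇^(n.-1) C];
    - hence [r 0] satisfies [∇^k (E ⊃ F)], so that everything above [r k], in
      particular every model of [Y], satisfies [E ⊃ F].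

    No model has to be built: the points above [r l] matter only through the set
    [T l] of formulas true at all of them, here [above_root], and truth at
    [r l] is then defined by recursion on formulas ([slash]).  The proof rests on
    two facts: the calculus is sound for [slash] ([slash_sound]), and
    slashed formulas belong to [T l] ([slash_theory]). *)

Set Implicit Arguments.
Unset Strict Implicit.
Unset Printing Implicit Defensive.

Local Open Scope form_scope.

(** * Derived rules *)

Lemma entails_closed (V : Type) (X A : form V) (Γ : seq (form V)) :
  Γ ⇒ Some A -> Forall (fun B => [:: X] ⇒ Some B) Γ -> [:: X] ⇒ Some A.
Proof.
move=> /(Lw X); elim: Γ => [|B Γ IH] // XBΓA /Forall_cons_iff [XB XΓ].
apply: IH => //; apply: Lc.
apply: (@Ex _ ((X :: Γ) ++ [:: X])).
  exact: Permutation_sym (Permutation_cons_append (X :: Γ) X).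
by apply: Cut XB _; apply: Ex XBΓA; exact: perm_swap.
Qed.

Lemma iKd_timp (V : Type) (X A : form V) :
  iKd (X ~> A) <-> [:: X] ⇒ Some A.
Proof.
split=> [/RuleN /= nXA | XA]; last exact: (@Rtimp _ [::]).
apply: (@Cut _ [::] [:: X] (Some A)) nXA _.
apply: Ltimp; first exact: Id.
apply: (@Ex _ [:: X; A]); first exact: perm_swap.
exact/Lw/Id.
Qed.

Lemma iter_RuleN (V : Type) (l : nat) (Γ : seq (form V)) (A : form V) :
  Γ ⇒ Some A -> [seq ∇^l B | B <- Γ] ⇒ Some (∇^l A).
Proof.
move=> ΓA; elim: l => [|l /RuleN /=]; first by rewrite map_id.
by rewrite -map_comp.
Qed.

Lemma bigand_entails (V : Type) (I : eqType) (f : I -> form V) (r : seq I)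
    (i : I) :
  i \in r -> [:: bigand (map f r)] ⇒ Some (f i).
Proof.
elim: r => [|j [|j' r] IH] //; first by rewrite inE => /eqP ->; exact: Id.
rewrite inE => /orP [/eqP -> | /IH ri]; first exact/Land1/Id.
exact: Land2.
Qed.

(** * The slash *)

(** What the slash needs of the sets [T l] of formulas true strictly above
    [r l]: everything above [r l] is mapped by [π] above [r l.+1]. *)
Definition temporal_theory (V : Type) (T : nat -> form V -> Prop) : Prop :=
  (forall l Γ A, Γ ⇒ Some A -> Forall (T l) Γ -> T l A)
  /\ (forall l A, T l.+1 A -> T l (∇ A)).

(** Truth at the new point [r l].  In the clause of [~>] the membership in [T l]
    accounts for the points mapped by [π] strictly above [r l], and [r l.-1], present only when [l > 0], is
    the one new point whose [π]-image is [r l]. *)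
Fixpoint slash (V : Type) (T : nat -> form V -> Prop) (l : nat) (A : form V)
  : Prop :=
  match A with
  | Atom p => T l (Atom p)
  | Top => True
  | Bot => False
  | B ∧ C => slash T l B /\ slash T l C
  | B ∨ C => slash T l B \/ slash T l C
  | B ⊃ C => T l (B ⊃ C) /\ (slash T l B -> slash T l C)
  | B ~> C =>
      T l (B ~> C)
      /\ (if l is l'.+1 then slash T l' B -> slash T l' C else True)
  | ∇ B => slash T l.+1 B
  end.

(** Persistence of truth from [r l] to the points above it. *)
Lemma slash_theory (V : Type) (T : nat -> form V -> Prop) (l : nat)
    (A : form V) :
  temporal_theory T -> slash T l A -> T l A.
Proof.
case=> Tded Tnabla.
have Tmono l' B C : [:: B] ⇒ Some C -> T l' B -> T l' C.
  by move=> BC TB; apply: Tded BC _; constructor.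
elim: A l => [p|||B IHB C IHC|B IHB C IHC|B _ C _|B _ C _|B IHB] l //=.
- by move=> _; apply: Tded (Rtop V) _.
- case=> /IHB TB /IHC TC; apply: (Tded l [:: B; C]); last by do !constructor.
  apply: Rand; last exact/Lw/Id.
  by apply: Ex (Lw C (Id B)); exact: perm_swap.
- by case=> [/IHB | /IHC]; apply: Tmono; [apply: Ror1 | apply: Ror2]; exact: Id.
- by case.
- by case.
- by move=> /IHB; exact: Tnabla.
Qed.

Lemma slash_sound (V : Type) (T : nat -> form V -> Prop) (l : nat)
    (Γ : seq (form V)) (Δ : option (form V)) :
  temporal_theory T -> Γ ⇒ Δ -> Forall (slash T l) Γ ->
  if Δ is Some A then slash T l A else False.
Proof.
move=> thT ΓΔ; elim: ΓΔ l => {Γ Δ}.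
- move=> Γ Γ' Δ eqΓ _ IH l sΓ'; apply: IH.
  exact: Permutation_Forall (Permutation_sym eqΓ) sΓ'.
- by move=> A l /Forall_cons_iff [].
- by move=> l /Forall_cons_iff [].
- by [].
- by move=> Γ Δ A _ IH l /Forall_cons_iff [_ /IH].
- by move=> Γ A _ IH l /IH.
- by move=> Γ Δ A _ IH l /Forall_cons_iff [sA sΓ]; apply: IH; do !constructor.
- move=> Γ Σ Δ A _ IHA _ IH l /Forall_app [sΣ /IHA sA].
  by apply: IH; constructor.
- move=> Γ Δ A B _ IH l /Forall_cons_iff [[sA _] sΓ].
  by apply: IH; constructor.
- move=> Γ Δ A B _ IH l /Forall_cons_iff [[_ sB] sΓ].
  by apply: IH; constructor.
- by move=> Γ A B _ IHA _ IHB l sΓ; split; [exact: IHA | exact: IHB].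
- move=> Γ Δ A B _ IHA _ IHB l /Forall_cons_iff [[sA | sB] sΓ].
    by apply: IHA; constructor.
  by apply: IHB; constructor.
- by move=> Γ A B _ IH l sΓ; left; exact: IH.
- by move=> Γ A B _ IH l sΓ; right; exact: IH.
- by move=> Γ [A|] _ IH l /Forall_map /IH.
- move=> Γ Δ A B _ IHA _ IHB l /Forall_cons_iff [/= [_ sAB] sΓ].
  by apply: IHB; constructor => //; exact/sAB/IHA.
- move=> Γ A B ΓAB IH l sΓ; split.
    apply: thT.1 (Rtimp ΓAB) _.
    by apply: Forall_impl sΓ => C; exact: slash_theory.
  case: l sΓ => // l sΓ sA; apply: IH; constructor=> //.
  exact/Forall_map.
- move=> Γ Δ A B _ IHA _ IHB l /Forall_cons_iff [/= [_ sAB] sΓ].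
  by apply: IHB; constructor => //; exact/sAB/IHA.
- move=> Γ A B ΓAB IH l sΓ; split.
    apply: thT.1 (Rhimp ΓAB) _.
    by apply: Forall_impl sΓ => C; exact: slash_theory.
  by move=> sA; apply: IH; constructor.
Qed.

Lemma slash_iter (V : Type) (T : nat -> form V -> Prop) (l m : nat)
    (A : form V) :
  slash T l (∇^m A) = slash T (l + m) A.
Proof. by elim: m l => [|m IH] l /=; rewrite ?addn0 // IH addSnnS. Qed.

Lemma slash_bigand (V : Type) (T : nat -> form V -> Prop) (l : nat)
    (I : Type) (f : I -> form V) (r : seq I) :
  (forall i, slash T l (f i)) -> slash T l (bigand (map f r)).
Proof.
by move=> sf; elim: r => [|i [|j r] IH] //=; split.
Qed.

(** * Two families of models above the new points *)

(** The formulas true at the [l]-fold [π]-images of the models of [X], and at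
    the [(l-k)]-fold images of those of [Y] as soon as [k <= l]. *)
Definition above_root (V : Type) (X Y : form V) (k l : nat) (A : form V)
  : Prop :=
  [:: X] ⇒ Some (∇^l A) /\ (k <= l -> [:: Y] ⇒ Some (∇^(l - k) A)).

Lemma above_root_theory (V : Type) (X Y : form V) (k : nat) :
  temporal_theory (above_root X Y k).
Proof.
split=> [l Γ A ΓA TΓ | l A [XA YA]].
- split=> [|kl].
    apply: entails_closed (iter_RuleN l ΓA) _.
    by apply/Forall_map; apply: Forall_impl TΓ => B [].
  apply: entails_closed (iter_RuleN (l - k) ΓA) _.
  by apply/Forall_map; apply: Forall_impl TΓ => B [_]; apply.
- split=> [|kl]; first by rewrite -iterSr.
  by rewrite -iterSr -subSn //; exact/YA/leqW.
Qed.

Theorem theorem17 (V : Type) (I J : finType) (m : I -> nat) (n : J -> nat)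
    (k : nat) (A B : I -> form V) (C D : J -> form V) (E F : form V) :
  iKd (((⋀_(i : I) ∇^(m i) (A i ⊃ B i)) ∧ (⋀_(j : J) ∇^(n j) (C j ~> D j)))
       ~> ∇^k (E ⊃ F)) ->
  (exists i0 : I,
     iKd (((⋀_(i : I) ∇^(m i) (A i ⊃ B i)) ∧ (⋀_(j : J) ∇^(n j) (C j ~> D j)))
          ~> ∇^(m i0) (A i0)))
  \/
  (exists j0 : J, 1 <= n j0 /\
     iKd (((⋀_(i : I) ∇^(m i) (A i ⊃ B i)) ∧ (⋀_(j : J) ∇^(n j) (C j ~> D j)))
          ~> ∇^(n j0 - 1) (C j0)))
  \/
  (exists (I' : {set I}) (J' : {set J}),
     (forall i, i \in I' -> k <= m i) /\ (forall j, j \in J' -> k <= n j) /\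
     iKd (((⋀_(i in I') ∇^(m i - k) (A i ⊃ B i))
           ∧ (⋀_(j in J') ∇^(n j - k) (C j ~> D j)) ∧ E)
          ~> F)).
Proof.
set X := (X in iKd (X ~> ∇^k (E ⊃ F))) => /iKd_timp XEF.
case: (classic (exists i0, iKd (X ~> ∇^(m i0) (A i0)))) => [|noA]; first by left.
right.
case: (classic (exists j0, 1 <= n j0 /\ iKd (X ~> ∇^(n j0 - 1) (C j0))))
  => [|noC]; first by left.
right; exists [set i | k <= m i], [set j | k <= n j].
split; first by move=> i; rewrite inE.
split; first by move=> j; rewrite inE.
set Y := (Y in iKd (Y ~> F)); apply/iKd_timp.
pose T := above_root X Y k.
have thT : temporal_theory T := above_root_theory X Y k.
have TA i : T (m i) (A i ⊃ B i).
  split=> [|km].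
    apply: Land1.
    by apply: (@bigand_entails _ _ (fun i => ∇^(m i) (A i ⊃ B i)));
      rewrite mem_enum.
  do 2!apply: Land1.
  by apply: (@bigand_entails _ _ (fun i => ∇^(m i - k) (A i ⊃ B i)));
    rewrite mem_enum inE.
have TC j : T (n j) (C j ~> D j).
  split=> [|kn].
    apply: Land2.
    by apply: (@bigand_entails _ _ (fun j => ∇^(n j) (C j ~> D j)));
      rewrite mem_enum.
  apply: Land1; apply: Land2.
  by apply: (@bigand_entails _ _ (fun j => ∇^(n j - k) (C j ~> D j)));
    rewrite mem_enum inE.
have sX : slash T 0 X.
  split; apply: slash_bigand => x; rewrite slash_iter add0n.
    split=> // /(slash_theory thT) [XA _].
    by case: noA; exists x; apply/iKd_timp.
  split=> //; case nx: (n x) => [//|l] /(slash_theory thT) [XC _].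
  by case: noC; exists x; rewrite nx subn1; split=> //; apply/iKd_timp.
have /= : slash T 0 (∇^k (E ⊃ F)).
  by apply: (slash_sound thT XEF); constructor.
rewrite slash_iter => -[[_ /(_ (leqnn k))]].
rewrite subnn /= => YEF _.
apply: (@entails_closed _ Y F [:: E ⊃ F; E]).
  apply: Lhimp; first exact: Id.
  by apply: Ex (Lw E (Id F)); exact: perm_swap.
constructor; first exact: YEF.
by constructor=> //; exact/Land2/Id.
Qed.
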